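(* Let $a,b>0$ and let $B\sim\mathrm{Beta}(a,b)$. Let $u\in[0,1]$ and $\eta\in[0,S(a,b,u)]$. If $u>\frac{a-\eta}{a+b-\eta}$, then $$\log\mathbb{P}(B\ge u)-\log\mathbb{P}\left(B\ge \frac{a-\eta}{a+b-\eta}\right)\le -(a+b-\eta)\,\mathrm{kl}\left(\frac{a-\eta}{a+b-\eta},\,u\right).$$
   Context: For $p,q\in[0,1]$, $\mathrm{kl}(p,q)=p\log(p/q)+(1-p)\log\frac{1-p}{1-q}\in[0,\infty]$, with the usual conventions ($0\log 0=0$, value $\infty$ if $q=0<p$ or $q=1>p$). Also $\log 0=-\infty$. $\mathrm{Beta}(a,b)$ is the distribution on $[0,1]$ with density $\frac{\Gamma(a+b)}{\Gamma(a)\Gamma(b)}x^{a-1}(1-x)^{b-1}$. $W_0$ denotes the principal branch of the Lambert W function (so $W_0(z)e^{W_0(z)}=z$, and $W_0(z)\ge 0$ for $z\ge0$). For $u\in[0,1]$, the function $S$ is defined by $$S(a,b,u)=\begin{cases} a & \text{if } a\le 1 \text{ or } u=0,\\[2pt] a-b\,\frac{a-1}{b+1} & \text{if } a>1,\ u=1,\\[4pt] a-b\,\frac{u}{1-u}+\dfrac{W_0\left(\frac{b\,u^{a-b\frac{u}{1-u}}}{1-u}\log\frac1u\right)}{\log\frac1u} & \text{if } a>1,\ u\in(0,1).\end{cases}$$ *)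

(* Defs.v *)
From HB Require Import structures.
From mathcomp Require Import all_boot all_order all_algebra.
From mathcomp Require Import all_classical all_reals all_analysis.
Set Implicit Arguments.
Unset Strict Implicit.
Unset Printing Implicit Defensive.
Import Order.TTheory GRing.Theory Num.Theory.
Import numFieldNormedType.Exports.
Local Open Scope classical_set_scope.
Local Open Scope ring_scope.

(* The totalized [ln] and division make the convention 0 log 0 = 0 automatic:
   a vanishing factor p or 1 - p kills its term. *)
Definition kl {R : realType} (p q : R) : \bar R :=
  if ((q == 0) && (0 < p)) || ((q == 1) && (p < 1)) then +oo%E
  else (p * ln (p / q) + (1 - p) * ln ((1 - p) / (1 - q)))%:E.

Definition Gamma {R : realType} (t : R) : R :=
  \int[lebesgue_measure]_(x in `[0, +oo[) (x `^ (t - 1) * expR (- x)).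

Definition beta_density {R : realType} (a b : R) : R -> R :=
  (fun x => Gamma (a + b) / (Gamma a * Gamma b)
            * x `^ (a - 1) * (1 - x) `^ (b - 1)) \_ `[0, 1].

(* The library's [beta_prob] only covers natural number parameters. *)
Definition is_Beta {R : realType} {d : measure_display} {T : measurableType d}
    {P : probability T R} (B : {RV P >-> R}) (a b : R) : Prop :=
  forall A : set R, measurable A ->
    distribution P B A
    = (\int[lebesgue_measure]_(x in A) (beta_density a b x)%:E)%E.

(* On the principal branch, W_0(z) is the solution w >= -1 of w e^w = z; the
   value is junk (0) for z < -1/e, where there is none. *)
Definition lambertW0 {R : realType} (z : R) : R :=
  xget 0 [set w : R | -1 <= w /\ w * expR w = z].

Lemma lambertW0_spec {R : realType} (z : R) : 0 <= z ->
  0 <= lambertW0 z /\ lambertW0 z * expR (lambertW0 z) = z.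
Proof.
move=> z0; rewrite /lambertW0; case: xgetP => [w _ [_ wz]|nw].
  by split=> //; rewrite -(pmulr_lge0 _ (expR_gt0 w)) wz.
have [||c] := @IVT R (fun w : R => w * expR w) 0 z z z0.
- apply: continuous_subspaceT => x.
  by apply: continuousM; [exact: cvg_id|exact: continuous_expR].
- have zz : z <= z * expR z by rewrite ler_peMr// -expR0 ler_expR.
  by rewrite mul0r min_l ?max_r ?z0 ?zz// (le_trans z0 zz).
rewrite in_itv/= => /andP[c0 _] cz.
by case: (nw c); split=> //; rewrite (le_trans _ c0)// lerN10.
Qed.

Definition Sfun {R : realType} (a b u : R) : R :=
  if (a <= 1) || (u == 0) then a
  else if u == 1 then a - b * ((a - 1) / (b + 1))
  else a - b * (u / (1 - u))
       + lambertW0 (b * u `^ (a - b * (u / (1 - u))) / (1 - u) * ln u^-1)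
         / ln u^-1.

(* Main.v *)
Require Import Defs.
From HB Require Import structures.
From mathcomp Require Import all_boot all_order all_algebra.
From mathcomp Require Import all_classical all_reals all_analysis.
From mathcomp Require Import measurable_realfun ring lra.
Import Order.TTheory GRing.Theory Num.Theory.
Import numFieldNormedType.Exports.
Local Open Scope classical_set_scope.
Local Open Scope ring_scope.

(** Write F x = P (B >= x), al = a - eta, n = al + b and p = al / n, so that
    n * kl p u = al * ln (p / u) + b * ln ((1 - p) / (1 - u)).  The claim is
    then [g u <= g p] for the ratio
      g x = F x / (x ^ al * (1 - x) ^ b),
    and it is enough that g is nonincreasing on [p, u].

    Let c be the normalizing constant of the density.  As F' is minus the
    density, g' has the sign opposite to that of the gap
      h x = c * x ^ a * (1 - x) ^ b / (n * x - al) - F x,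
    and the task is to show [0 <= h] on ]p, u].  The derivative of h has a
    single factor of variable sign, the affine (eta - 1) * n * x - eta * al
    ([is_derive_gap]), and h tends to 0 at 1.  If this factor is nonpositive
    up to 1, then h decreases to 0, hence is nonnegative.  Otherwise eta > 1
    and h decreases up to the turning point eta * al / ((eta - 1) * n), then
    increases strictly to 0: it is negative near 1, and what must be excluded
    is that it is already negative at u.

    This is where the bound eta <= S a b u comes in.  Undoing the Lambert
    function, it amounts to
      n * u - al <= b * u ^ eta
    ([Sfun_lambert]).  Were h u negative, h would be nonpositive on [u, 1[, so
    g would be nondecreasing there and g u would be at most the limit c / b of
    g at 1 ([ratio_le_lim]).  Then F u is at most
    (c / b) * u ^ al * (1 - u) ^ b; multiplying by the displayed inequality
    bounds F u * (n * u - al) by c * u ^ a * (1 - u) ^ b, that is, h u is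
    nonnegative after all ([gap_ge0_u]).

    The value of c, and the integrability of the density, never have to be
    computed from Gamma: both are forced by the law having total mass 1
    ([beta_const_gt0], [integrable_beta_density]). *)

(** * Calculus on an interval *)

Lemma is_derive_le0 (R : realType) (f df : R -> R) (x y : R) : x <= y ->
  {within `[x, y], continuous f} ->
  (forall z, x < z < y -> is_derive z 1 f (df z)) ->
  (forall z, x < z < y -> df z <= 0) -> f y <= f x.
Proof.
rewrite le_eqVlt => /predU1P[<-//|xy] fc fd df0.
have fd' z : z \in `]x, y[%R -> is_derive z 1 f (df z).
  by rewrite in_itv; exact: fd.
have [z + fE] := MVT xy fd' fc.
rewrite in_itv/= => zxy; rewrite -subr_le0 fE mulr_le0_ge0 ?df0//; lra.
Qed.

Lemma is_derive_lt0 (R : realType) (f df : R -> R) (x y : R) : x < y ->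
  {within `[x, y], continuous f} ->
  (forall z, x < z < y -> is_derive z 1 f (df z)) ->
  (forall z, x < z < y -> df z < 0) -> f y < f x.
Proof.
move=> xy fc fd df0.
have fd' z : z \in `]x, y[%R -> is_derive z 1 f (df z).
  by rewrite in_itv; exact: fd.
have [z + fE] := MVT xy fd' fc.
rewrite in_itv/= => zxy; rewrite -subr_lt0 fE nmulr_rlt0 ?df0//; lra.
Qed.

Lemma is_derive_within (R : realType) (f df : R -> R) (x y : R) :
  (forall z, x <= z <= y -> is_derive z 1 f (df z)) ->
  {within `[x, y], continuous f}.
Proof.
move=> fd; apply: derivable_within_continuous => z; rewrite in_itv/= => zxy.
by have [] := fd z zxy.
Qed.

Lemma is_derive_onem_powR (R : realType) (e x : R) : x < 1 ->
  is_derive x 1 (fun y => (1 - y) `^ e) (- (e * (1 - x) `^ (e - 1))).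
Proof.
move=> x1; have dpow := @is_derive1_powR R e (1 - x) ltac:(lra).
have donem : is_derive x 1 (fun y : R => 1 - y) (-1).
  by apply: is_derive_eq; ring.
have dcomp := @is_derive1_comp R (@powR R ^~ e) (fun y => 1 - y) x _ _ dpow donem.
by apply: (is_derive_eq dcomp); ring.
Qed.

Lemma ge_at_left1 (R : realType) (f : R -> R) (k l u : R) : u < 1 ->
  f y @[y --> 1^'-] --> l -> (forall y, u < y < 1 -> k <= f y) -> k <= l.
Proof.
move=> u1 fl kf.
rewrite -(cvg_lim (@Rhausdorff R) fl); apply: limr_ge; first exact/cvgP/fl.
by near=> y; apply: kf; apply/andP; split; near: y;
  [exact: nbhs_left_gt|exact: nbhs_left_lt].
Unshelve. all: by end_near. Qed.

(** * The weights x ^ a (1 - x) ^ b *)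

Definition beta_weight {R : realType} (a b x : R) : R := x `^ a * (1 - x) `^ b.

Lemma beta_weight_gt0 (R : realType) (a b x : R) : 0 < x < 1 ->
  0 < beta_weight a b x.
Proof. by move=> /andP[x0 x1]; rewrite mulr_gt0 ?powR_gt0 ?subr_gt0. Qed.

Lemma beta_weightD (R : realType) (a b a' b' x : R) : 0 < x < 1 ->
  beta_weight (a + a') (b + b') x = beta_weight a b x * beta_weight a' b' x.
Proof.
move=> /andP[x0 x1]; rewrite /beta_weight !powRD; first ring.
all: by apply/implyP => _; lra.
Qed.

(** The factor x (1 - x) is what separates the density, with exponents a - 1 and
    b - 1, from the numerator of the gap, with exponents a and b. *)
Lemma beta_weight_pred (R : realType) (a b x : R) : 0 < x < 1 ->
  beta_weight a b x = beta_weight (a - 1) (b - 1) x * (x * (1 - x)).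
Proof.
move=> x01; have := @beta_weightD R (a - 1) (b - 1) 1 1 x x01.
rewrite !subrK => ->; congr (_ * _).
by rewrite /beta_weight !powRr1//; lra.
Qed.

Lemma is_derive_beta_weight (R : realType) (a b x : R) : 0 < x < 1 ->
  is_derive x 1 (beta_weight a b)
    (beta_weight (a - 1) (b - 1) x * (a - (a + b) * x)).
Proof.
move=> x01; have [x0 x1] := andP x01.
have da := @is_derive1_powR R a x x0.
have db := @is_derive_onem_powR R b x x1.
have powRS (y e : R) : 0 < y -> y `^ e = y `^ (e - 1) * y.
  move=> y0; rewrite -[X in _ * X]powRr1 ?ltW// -powRD ?subrK//.
  by rewrite (gt_eqF y0) implybT.
apply: (is_derive_eq (is_deriveM da db)).
by rewrite /GRing.scale/= /beta_weight (powRS x a)// (powRS (1 - x) b); [ring|lra].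
Qed.

(** The three facts about the survival function x |-> P (B >= x) on which the
    analytic argument rests; the constant c is left abstract. *)
Definition is_beta_tail {R : realType} (c a b : R) (F : R -> R) : Prop :=
  [/\ {within `[0, 1], continuous F}, F 1 = 0 &
      forall x : R, 0 < x < 1 ->
        is_derive x 1 F (- (c * beta_weight (a - 1) (b - 1) x))].

(** * Monotonicity of the normalized tail *)

Section beta_tail.
Context (R : realType) (c a b : R) (F : R -> R).
Context (c0 : 0 < c) (b0 : 0 < b) (tF : is_beta_tail c a b F).

Lemma beta_tail_within (x y : R) : 0 <= x -> y <= 1 ->
  {within `[x, y], continuous F}.
Proof.
have [Fc _ _] := tF => x0 y1; apply: continuous_subspaceW Fc.
by apply: subset_itv; rewrite bnd_simp.
Qed.

Lemma beta_tail_gt0 (x : R) : 0 <= x < 1 -> 0 < F x.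
Proof.
have [_ F1 Fd] := tF => /andP[x0 x1]; rewrite -F1.
apply: (@is_derive_lt0 R F (fun z => - (c * beta_weight (a - 1) (b - 1) z))).
- exact: x1.
- exact: beta_tail_within.
- by move=> z xz; apply: Fd; lra.
- by move=> z xz; rewrite oppr_lt0 mulr_gt0// beta_weight_gt0//; lra.
Qed.

Lemma beta_tail_cvg0 : F y @[y --> 1^'-] --> 0.
Proof.
have [Fc <- _] := tF.
by have /(continuous_within_itvP _ ltr01)[] := Fc.
Qed.

Lemma cvg_onem_powR : (1 - y) `^ b @[y --> 1^'-] --> 0.
Proof.
apply: (@cvg_comp _ _ _ (fun y : R => 1 - y) (@powR R ^~ b) _ (0^'+)).
  move=> A [d /= d0 dA]; exists d => //= y dy y1; apply: dA; rewrite /= ?subr_gt0//.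
  by rewrite sub0r normrN.
exact: powR_cvg0.
Qed.

(** For a >= 1 the factor t ^ (a - 1) of the density is at most 1, and
    c * (1 - t) ^ (b - 1) integrates to the right-hand side over [y, 1].  In
    differential form: the difference of the two sides is nonincreasing, and at
    1 it is at least the limit 0 of - F. *)
Lemma beta_tail_le (y : R) : 1 <= a -> 0 < y < 1 ->
  F y <= c / b * (1 - y) `^ b.
Proof.
move=> a1 /andP[y0 y1]; rewrite -subr_ge0.
pose D (z : R) := c / b * (1 - z) `^ b - F z.
suff: 0 <= D y by [].
have Dd (z : R) : 0 < z < 1 -> is_derive z 1 D
   (c * (z `^ (a - 1) - 1) * (1 - z) `^ (b - 1)).
  move=> z01; have [_ _ Fd] := tF.
  have db : is_derive z 1 _ _ := @is_derive_onem_powR R b z ltac:(lra).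
  apply: (is_derive_eq (is_deriveB (is_deriveZ (c / b) db) (Fd z z01))).
  by rewrite /GRing.scale/= /beta_weight; field; rewrite gt_eqF.
rewrite -oppr_le0; apply: (@ge_at_left1 R F _ _ y y1 beta_tail_cvg0) => z yz.
rewrite -lerN2 opprK; apply: (@le_trans _ _ (D z)).
  by rewrite -subr_ge0 opprK subrK mulr_ge0 ?powR_ge0// divr_ge0// ltW.
apply: (@is_derive_le0 R D (fun z => c * (z `^ (a - 1) - 1) * (1 - z) `^ (b - 1))); first lra.
- by apply: is_derive_within => t tyz; apply: Dd; lra.
- by move=> t tyz; apply: Dd; lra.
- move=> t tyz; rewrite mulr_le0_ge0 ?powR_ge0// mulr_ge0_le0 ?(ltW c0)// subr_le0.
  by rewrite -[leRHS](powRr0 t); apply: ger_powR; lra.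
Qed.

Context (eta al u : R).
Let n := al + b.
Context (eta0 : 0 <= eta) (al0 : 0 <= al) (aE : a = al + eta).

(* The gap: its sign is opposite to that of the derivative of the ratio g. *)
Let h (x : R) := c * beta_weight a b x / (n * x - al) - F x.

(** Up to the factor c * beta_weight (a - 1) (b - 1) x, the numerator over
    (n x - al)^2 is (a - (a + b) x) (n x - al) - n x (1 - x) + (n x - al)^2.
    Since a - (a + b) x + (n x - al) = eta (1 - x), its outer terms add up to
    eta (1 - x) (n x - al), so that 1 - x factors out. *)
Lemma is_derive_gap (x : R) : 0 < x < 1 -> al < n * x -> is_derive x 1 h
  (c * beta_weight (a - 1) (b - 1) x * (1 - x) / (n * x - al) ^+ 2
   * ((eta - 1) * n * x - eta * al)).
Proof.
move=> x01 alx; have [_ _ Fd] := tF.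
have nz : n * x - al != 0 by rewrite gt_eqF// subr_gt0.
have dl : is_derive x 1 (fun y : R => n * y - al) n.
  by apply: is_derive_eq; rewrite /GRing.scale/=; ring.
have dV := @is_deriveV R (fun y => n * y - al) x n 1 nz dl.
have dw := is_deriveZ c (@is_derive_beta_weight R a b x x01).
apply: (is_derive_eq (is_deriveB (is_deriveM dw dV) (Fd x x01))).
rewrite /= /GRing.scale/= (@beta_weight_pred R a b x x01).
set w := beta_weight _ _ x; rewrite aE /n in nz *.
by field.
Qed.

Let dh (x : R) := c * beta_weight (a - 1) (b - 1) x * (1 - x) / (n * x - al) ^+ 2
   * ((eta - 1) * n * x - eta * al).

Lemma gap_factor_gt0 (x : R) : 0 < x < 1 -> al < n * x ->
  0 < c * beta_weight (a - 1) (b - 1) x * (1 - x) / (n * x - al) ^+ 2.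
Proof.
move=> x01 alx; rewrite divr_gt0 ?exprn_gt0 ?subr_gt0//.
by rewrite mulr_gt0 ?(mulr_gt0 c0) ?beta_weight_gt0//; lra.
Qed.

Lemma slope_gt0 : 0 < n. Proof. by rewrite ltr_wpDl. Qed.

Lemma al_lt_le_trans (x y : R) : al < n * x -> x <= y -> al < n * y.
Proof. by move=> + xy => /lt_le_trans; apply; rewrite ler_pM2l ?slope_gt0. Qed.

Lemma gap_within (x y : R) : 0 < x -> y < 1 -> al < n * x ->
  {within `[x, y], continuous h}.
Proof.
move=> x0 y1 alx; apply: is_derive_within => z xzy; apply: is_derive_gap; first lra.
by apply: al_lt_le_trans alx _; lra.
Qed.

Lemma gap_nincr (x y : R) : 0 < x -> x <= y -> y < 1 -> al < n * x ->
  (eta - 1) * n * y <= eta * al -> h y <= h x.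
Proof.
move=> x0 xy y1 alx yeta; apply: (@is_derive_le0 R h dh) => //.
- exact: gap_within.
- move=> z xzy; apply: is_derive_gap; first lra.
  by apply: al_lt_le_trans alx _; lra.
- move=> z xzy; rewrite pmulr_rle0; last first.
    apply: gap_factor_gt0; first lra.
    by apply: al_lt_le_trans alx _; lra.
  rewrite subr_le0; have [e1|e1] := leP eta 1.
    apply: (@le_trans _ _ 0); last exact: mulr_ge0.
    rewrite mulr_le0_ge0//; last lra.
    by rewrite mulr_le0_ge0//; [lra|exact/ltW/slope_gt0].
  apply: le_trans yeta; rewrite ler_pM2l; last by rewrite mulr_gt0 ?slope_gt0//; lra.
  lra.
Qed.

Lemma gap_incr (x y : R) : 0 < x -> x < y -> y < 1 -> al < n * x ->
  1 < eta -> eta * al <= (eta - 1) * n * x -> h x < h y.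
Proof.
move=> x0 xy y1 alx eta1 xeta; rewrite -ltrN2.
apply: (@is_derive_lt0 R (fun z => - h z) (fun z => - dh z)) => //.
- by move=> z; apply: continuousN; exact: gap_within.
- move=> z xzy; apply: is_deriveN; apply: is_derive_gap; first lra.
  by apply: al_lt_le_trans alx _; lra.
- move=> z xzy; rewrite oppr_lt0 pmulr_rgt0; last first.
    apply: gap_factor_gt0; first lra.
    by apply: al_lt_le_trans alx _; lra.
  rewrite subr_gt0; apply: le_lt_trans xeta _.
  rewrite ltr_pM2l; last by rewrite mulr_gt0 ?slope_gt0//; lra.
  lra.
Qed.

Let g (x : R) := F x * beta_weight (- al) (- b) x.

Lemma gapE (x : R) : al < n * x ->
  (F x * (n * x - al) <= c * beta_weight a b x) = (0 <= h x).
Proof. by move=> alx; rewrite subr_ge0 ler_pdivlMr// subr_gt0. Qed.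

Lemma is_derive_ratio (x : R) : 0 < x < 1 ->
  is_derive x 1 g (beta_weight (- al - 1) (- b - 1) x *
    (F x * (n * x - al) - c * beta_weight a b x)).
Proof.
move=> x01; have [_ _ Fd] := tF.
apply: (is_derive_eq (is_deriveM (Fd x x01) (@is_derive_beta_weight R (- al) (- b) x x01))).
rewrite /GRing.scale/= (@beta_weight_pred R a b x x01) (@beta_weight_pred R (- al) (- b) x x01) /n.
ring.
Qed.

Context (u01 : 0 < u < 1) (alu : al < n * u).

(** Beyond the turning point h increases, and the positive term of h tends to 0
    at 1 because b > 0. *)
Lemma gap_le0_right (y : R) : u <= y < 1 -> 1 < eta ->
  eta * al <= (eta - 1) * n * y -> h y <= 0.
Proof.
move=> uy1 eta1 yeta; have [u0 u1] := andP u01.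
have aly : al < n * y by apply: al_lt_le_trans alu _; lra.
have y1 : y < 1 by lra.
have lim0 : c / (n * y - al) * (1 - z) `^ b @[z --> 1^'-] --> 0.
  rewrite -[X in _ --> X](mulr0 (c / (n * y - al))).
  by apply: cvgMr; exact: cvg_onem_powR.
apply: (ge_at_left1 _ _ _ _ _ y1 lim0) => z yz1.
have alz : al < n * z by apply: al_lt_le_trans aly _; lra.
have z01 : 0 < z < 1 by lra.
have fz : 0 <= F z by apply/ltW/beta_tail_gt0; lra.
apply: (@le_trans _ _ (h z)).
  by apply/ltW/gap_incr => //; lra.
rewrite lerBlDr ler_wpDr// mulrAC; apply: ler_pM.
- by rewrite mulr_ge0 ?(ltW c0)// invr_ge0 subr_ge0 ltW.
- exact/ltW/beta_weight_gt0.
- rewrite ler_pM2l// lef_pV2 ?posrE ?subr_gt0//.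
  by rewrite lerD2r ler_pM2l ?slope_gt0//; lra.
- rewrite /beta_weight ler_piMl ?powR_ge0// -[leRHS](powRr0 z).
  have a0 : 0 <= a by rewrite aE addr_ge0.
  by apply: ger_powR => //; lra.
Qed.

(** Where the gap is nonpositive the ratio g is nondecreasing, so it stays below
    its limit at 1, which is at most c / b by [beta_tail_le]. *)
Lemma ratio_le_lim : 1 <= a -> (forall x, u < x < 1 -> h x <= 0) ->
  g u <= c / b.
Proof.
move=> a1 hneg; have [u0 u1] := andP u01.
have lim1 : c / b * y `^ (- al) @[y --> 1^'-] --> c / b.
  rewrite -[X in _ --> X]mulr1; apply: cvgMr.
  have /differentiable_continuous : differentiable (@powR R ^~ (- al)) (1 : R).
    apply/derivable1_diffP.
    by have [] := @is_derive1_powR R (- al) 1 ltr01.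
  by rewrite /prop_for /continuous_at /= powR1; exact: cvg_at_left_filter.
apply: (ge_at_left1 _ _ _ _ _ u1 lim1) => y uy.
have y01 : 0 < y < 1 by lra.
apply: (@le_trans _ _ (g y)).
  rewrite -lerN2.
  apply: (@is_derive_le0 R (fun z => - g z) (fun z => - (beta_weight (- al - 1) (- b - 1) z *
    (F z * (n * z - al) - c * beta_weight a b z)))); first lra.
  - move=> z; apply: continuousN; apply: is_derive_within => t ty.
    by apply: is_derive_ratio; lra.
  - by move=> z zy; apply: is_deriveN; apply: is_derive_ratio; lra.
  - move=> z zy; have z01 : 0 < z < 1 by lra.
    rewrite oppr_le0 mulr_ge0 ?(ltW (beta_weight_gt0 _ _ _ _ z01))// subr_ge0.
    have alz : al < n * z by apply: al_lt_le_trans alu _; lra.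
    have /hneg : u < z < 1 by lra.
    by rewrite subr_le0 ler_pdivrMr// subr_gt0.
rewrite /g /beta_weight mulrCA mulrC ler_wpM2r ?powR_ge0//.
rewrite powRN ler_pdivrMr ?powR_gt0//; last lra.
exact: beta_tail_le.
Qed.

(** For eta <= 1 the affine factor is nonpositive on all of [0, 1], because
    0 <= eta * al. *)
Lemma eta_gt1 (y : R) : 0 < y -> eta * al < (eta - 1) * n * y -> 1 < eta.
Proof.
move=> y0; apply: contraTT; rewrite -!leNgt => eta1.
apply: (@le_trans _ _ 0); last exact: mulr_ge0.
by rewrite -mulrA mulr_le0_ge0 ?subr_le0// mulr_ge0// ltW// slope_gt0.
Qed.

Context (Su : n * u - al <= b * u `^ eta).

(** If the affine factor is nonpositive up to 1, then h decreases from u on and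
    stays above - F, which tends to 0.  Otherwise h u < 0 would bound the ratio g
    at u by c / b, and [Su] turns this bound into 0 <= h u. *)
Lemma gap_ge0_u : 0 <= h u.
Proof.
have [u0 u1] := andP u01.
have [xs1|xs1] := leP ((eta - 1) * n) (eta * al).
  rewrite -oppr_le0; apply: (ge_at_left1 _ _ _ _ _ u1 beta_tail_cvg0) => y uy.
  have aly : al < n * y by apply: al_lt_le_trans alu _; lra.
  rewrite lerNl; apply: (@le_trans _ _ (h y)).
    rewrite -[leLHS]add0r lerD2r divr_ge0 ?subr_ge0 ?(ltW aly)// mulr_ge0 ?(ltW c0)//.
    by apply/ltW/beta_weight_gt0; lra.
  apply: gap_nincr => //; try lra.
  have [e1|e1] := leP eta 1.
    apply: (@le_trans _ _ 0); last exact: mulr_ge0.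
    rewrite -mulrA mulr_le0_ge0 ?subr_le0// mulr_ge0 ?(ltW slope_gt0)//; lra.
  apply: le_trans xs1; rewrite ler_piMr//; last lra.
  by rewrite mulr_ge0 ?(ltW slope_gt0)//; lra.
have eta1 : 1 < eta by apply: (@eta_gt1 1); rewrite ?mulr1.
rewrite leNgt; apply/negP => hu.
have hneg y : u < y < 1 -> h y <= 0.
  move=> uy; have [yx|yx] := leP ((eta - 1) * n * y) (eta * al).
    by apply: (@le_trans _ _ (h u)); [apply: gap_nincr => //; lra|exact: ltW].
  by apply: gap_le0_right => //; [lra|exact: ltW].
have gu : g u <= c / b by apply: ratio_le_lim => //; rewrite aE; move: al0; lra.
have wu := beta_weight_gt0 _ al b u u01.
move: hu; rewrite ltNge -gapE// => /negP; apply.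
have Fu : F u <= c / b * beta_weight al b u.
  move: gu; rewrite -(ler_pM2r wu) /g -[leLHS]mulrA -beta_weightD// !addNr.
  by rewrite /beta_weight !powRr0 !mulr1.
apply: (@le_trans _ _ (c / b * beta_weight al b u * (b * u `^ eta))).
  apply: ler_pM => //; last by rewrite subr_ge0 ltW.
  by apply/ltW/beta_tail_gt0; lra.
rewrite aE /beta_weight powRD; last by rewrite (gt_eqF u0) implybT.
by rewrite le_eqVlt; apply/orP; left; apply/eqP; field; rewrite gt_eqF.
Qed.

(** Since h is strictly increasing and nonpositive beyond the turning point, the
    sign of h u shows that u does not lie beyond it; so h decreases up to u. *)
Lemma gap_ge0 (x : R) : al < n * x -> 0 < x <= u -> 0 <= h x.
Proof.
move=> alx xu; have hu := gap_ge0_u; have [u0 u1] := andP u01.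
have [xs|xs] := leP ((eta - 1) * n * u) (eta * al).
  by apply: le_trans hu _; apply: gap_nincr => //; lra.
have eta1 : 1 < eta by apply: eta_gt1 xs; lra.
pose y := (u + 1) / 2.
have uy : u < y < 1 by rewrite /y; lra.
have : h u < h y by apply: gap_incr => //; [lra|lra|exact: ltW].
rewrite ltNge (le_trans _ hu)//; apply: gap_le0_right => //; first lra.
apply: (le_trans (ltW xs)); rewrite ler_pM2l; last first.
  by rewrite mulr_gt0 ?slope_gt0//; lra.
lra.
Qed.

(** The point p = 0 is allowed: there al = 0, so the possibly singular factor
    x ^ (- al) of g is constantly 1, also at 0. *)
Lemma ratio_le (p : R) : 0 <= p -> n * p = al -> g u <= g p.
Proof.
move=> p0 pE; have n0 := slope_gt0; have [u0 u1] := andP u01.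
have pu : p < u by rewrite -(ltr_pM2l n0) pE.
apply: (@is_derive_le0 R g (fun x => beta_weight (- al - 1) (- b - 1) x *
    (F x * (n * x - al) - c * beta_weight a b x))).
- exact: ltW.
- move=> x; apply: continuousM; first by apply: beta_tail_within; lra.
  move: x; move: p0; rewrite le_eqVlt => /predU1P[p0|p0].
    have al00 : al = 0 by rewrite -pE -p0 mulr0.
    have -> : beta_weight (- al) (- b) = beta_weight 0 (- b) by rewrite al00 oppr0.
    have -> : beta_weight 0 (- b) = fun y => (1 - y) `^ (- b).
      by apply/funext => y; rewrite /beta_weight powRr0 mul1r.
    by apply: is_derive_within => z pz; apply: is_derive_onem_powR; lra.
  by apply: is_derive_within => z pz; apply: is_derive_beta_weight; lra.
- by move=> x px; apply: is_derive_ratio; lra.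
- move=> x px; rewrite mulr_ge0_le0 ?subr_le0//.
    by apply/ltW/beta_weight_gt0; lra.
  have alx : al < n * x by rewrite -pE ltr_pM2l//; lra.
  by rewrite gapE//; apply: gap_ge0 => //; lra.
Qed.

End beta_tail.

(** * The survival function of a Beta law *)

Section beta_law.
Context {R : realType} {d : measure_display} {T : measurableType d}.
Context {P : probability T R} (B : {RV P >-> R}) (a b : R).
Context (B_Beta : is_Beta B a b).

Let c : R := Gamma (a + b) / (Gamma a * Gamma b).
Let mu := @lebesgue_measure R.
Let dens : R -> R := beta_density a b.

Lemma beta_densityE (x : R) : 0 <= x <= 1 ->
  dens x = c * beta_weight (a - 1) (b - 1) x.
Proof.
by move=> x01; rewrite /dens /beta_density patchE mem_set// /beta_weight mulrA.
Qed.

Lemma beta_density_out (x : R) : ~~ (0 <= x <= 1) -> dens x = 0.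
Proof.
by move=> x01; rewrite /dens /beta_density patchE memNset//= in_itv; apply/negP.
Qed.

Lemma beta_weight_ge0 (e f x : R) : 0 <= beta_weight e f x.
Proof. by rewrite mulr_ge0 ?powR_ge0. Qed.

Lemma measurable_beta_density (D : set R) : measurable_fun D dens.
Proof.
apply: (@measurable_funTS _ _ _ _ _ dens).
apply/(measurable_restrictT _ _).1 => //; apply: measurable_funTS.
apply: measurable_funM.
  by apply: measurable_funM => //; exact: measurable_powR.
apply: (@measurableT_comp _ _ _ _ _ _ (@powR R ^~ (b - 1))).
  exact: measurable_powR.
exact: measurable_funB.
Qed.

Lemma beta_density_total : (\int[mu]_x (dens x)%:E = 1)%E.
Proof.
by rewrite -(B_Beta _ measurableT) /distribution /pushforward preimage_setT probability_setT.
Qed.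

(** A nonpositive density could not have total mass 1, whatever the values of
    the Gamma integrals. *)
Lemma beta_const_gt0 : 0 < c.
Proof.
rewrite ltNge; apply/negP => c0.
have dens0 x : dens x <= 0.
  have [x01|x01] := boolP (0 <= x <= 1); last by rewrite beta_density_out.
  by rewrite beta_densityE// mulr_le0_ge0// beta_weight_ge0.
have := beta_density_total; rewrite integralE.
under eq_integral => x _ do rewrite funeposE max_r ?lee_fin//.
rewrite integral0 sub0e.
move=> e1; have : (0 <= \int[mu]_x (fun x => (dens x)%:E)^\- x)%E by apply: integral_ge0.
by rewrite -oppe_le0 e1 lee_fin ler10.
Qed.

Lemma beta_density_ge0 (x : R) : 0 <= dens x.
Proof.
have [x01|x01] := boolP (0 <= x <= 1); last by rewrite beta_density_out.
by rewrite beta_densityE// mulr_ge0 ?beta_weight_ge0// ltW// beta_const_gt0.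
Qed.

Lemma integrable_beta_density (D : set R) : measurable D ->
  mu.-integrable D (EFin \o dens).
Proof.
move=> mD; apply: (@integrableS _ _ _ _ setT) => //.
apply/integrableP; split; first by apply/measurable_EFinP; exact: measurable_beta_density.
under eq_integral => x _ do rewrite /= ger0_norm ?beta_density_ge0//.
by rewrite beta_density_total ltry.
Qed.

(** Written as a complement to 1 so that the integral has a variable upper end,
    as the fundamental theorem of calculus requires. *)
Definition beta_survival (x : R) : R := 1 - \int[mu]_(t in `[0, x]) dens t.

Lemma beta_survivalP (x : R) : 0 <= x ->
  P [set w | x <= B w] = (beta_survival x)%:E.
Proof.
move=> x0.
have -> : [set w | x <= B w] = ~` (B @^-1` `]-oo, x[).
  apply/seteqP; split => w /=; rewrite in_itv/=.
    by move=> xB; apply/negP; rewrite -leNgt.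
  by move/negP; rewrite -leNgt.
rewrite probability_setC; last by rewrite -[X in measurable X]setTI; exact: measurable_funP.
have -> : P (B @^-1` `]-oo, x[) = (\int[mu]_(t in `]-oo, x[) (dens t)%:E)%E.
  exact: (B_Beta _ (measurable_itv _)).
rewrite integral_itv_bndo_bndc; last by apply/measurable_EFinP; exact: measurable_beta_density.
rewrite (_ : (\int[mu]_(t in `]-oo, x]) (dens t)%:E)%E = (\int[mu]_(t in `[0%R, x]) (dens t)%:E)%E).
  rewrite EFinB /Rintegral fineK//.
  exact/integrable_fin_num/integrable_beta_density.
rewrite integral_mkcond [RHS]integral_mkcond; apply: eq_integral => t _.
rewrite !patchE; have [t0|t0] := leP 0 t.
  by congr (if _ then _ else _); apply/idP/idP; rewrite !inE/= !in_itv/= t0.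
by rewrite beta_density_out ?if_same// negb_and -ltNge t0.
Qed.

Lemma beta_survival1 : beta_survival 1 = 0.
Proof.
rewrite /beta_survival /Rintegral.
rewrite (_ : (\int[mu]_(t in `[0%R, 1%R]) (dens t)%:E)%E = (\int[mu]_t (dens t)%:E)%E).
  by rewrite beta_density_total subrr.
rewrite integral_mkcond; apply: eq_integral => t _.
rewrite patchE; case: ifPn => //; rewrite notin_setE /= in_itv => /negP t01.
by rewrite beta_density_out.
Qed.

Lemma is_beta_tail_survival : is_beta_tail c a b beta_survival.
Proof.
have id D := @integrable_beta_density D.
split; [|exact: beta_survival1|].
  have := parameterized_integral_continuous ler01 (id _ (measurable_itv `[0%R, 1%R])).
  move=> cF; have -> : beta_survival = cst 1 \- (fun x => \int[mu]_(t in `[0, x]) dens t) by [].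
  apply: within_continuousB; last exact: cF.
  by apply: continuous_subspaceT => x; exact: cst_continuous.
move=> x x01; have [x0 x1] := andP x01.
have dE : \forall y \near x, dens y = c * beta_weight (a - 1) (b - 1) y.
  near=> y; rewrite beta_densityE//; apply/andP; split; apply/ltW; near: y.
    exact: lt_nbhsr.
  exact: lt_nbhsl.
have cd : {for x, continuous dens}.
  have [dw _] := @is_derive_beta_weight R (a - 1) (b - 1) x x01.
  have /differentiable_continuous cw : differentiable (c *: beta_weight (a - 1) (b - 1)) x.
    by apply/derivable1_diffP; exact: derivableZ.
  rewrite /prop_for /continuous_at beta_densityE; last by rewrite !ltW.
  apply: cvg_trans cw; apply: near_eq_cvg.
  by near=> y; rewrite /= (near dE).
have [dF dFE] := @continuous_FTC1_closed R dens 0 x 1 x1 (id _ (measurable_itv _)) x0 cd.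
have dF' : is_derive x 1 (fun x => \int[mu]_(t in `[0, x]) dens t) (dens x).
  by rewrite -dFE derive1E; exact: derivableP.
have dS := is_deriveB (is_derive_cst (1 : R) x (1 : R)) dF'.
apply: (is_derive_eq dS).
by rewrite sub0r beta_densityE// !ltW.
Unshelve. all: by end_near. Qed.

End beta_law.

(** * What the bound by S gives *)

(** The left-hand side is b u - (a - eta) (1 - u), which is at most b u, and
    u <= u ^ eta for eta <= 1. *)
Lemma le_powR_of_eta_le1 (R : realType) (a b u eta : R) : 0 < b -> 0 < u < 1 ->
  0 <= eta -> eta <= a -> eta <= 1 ->
  (a + b - eta) * u - (a - eta) <= b * u `^ eta.
Proof.
move=> b0 u01 eta0 etaa eta1.
apply: (@le_trans _ _ (b * u)); first by rewrite -subr_ge0; nra.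
rewrite ler_pM2l// -[leLHS]powRr1; last lra.
by apply: ger_powR; lra.
Qed.

(** With v = a - b u / (1 - u), L = ln (1 / u) and z the argument of W_0 in S,
    the bound says that t = eta - v satisfies t L <= W_0 z.  The left-hand side
    of the claim is t (1 - u), so only t > 0 is of interest.  As w |-> w e^w
    increases on w >= 0, it gives t L e^(t L) <= z, where e^(t L) = u ^ (- t);
    clearing denominators and using eta = v + t yields the claim. *)
Lemma Sfun_lambert (R : realType) (a b u eta : R) : 0 < b -> 0 < u < 1 ->
  1 < a -> eta <= Sfun a b u ->
  (a + b - eta) * u - (a - eta) <= b * u `^ eta.
Proof.
move=> b0 u01 a1; have [u0 u1] := andP u01.
rewrite /Sfun (gt_eqF u0) (lt_eqF u1) (leNgt a 1) a1/=.
set z := b * _ / _ * _; set v := a - b * (u / (1 - u)).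
have L0 : 0 < ln u^-1 by rewrite ln_gt0// invf_gt1.
have z0 : 0 <= z.
  by rewrite mulr_ge0 ?(ltW L0)// divr_ge0 ?subr_ge0 ?(ltW u1)// mulr_ge0 ?powR_ge0// ltW.
have [w0 wz] := lambertW0_spec z0.
move: (lambertW0 z) w0 wz => w w0 wz etaS.
pose t := eta - v.
have tw : t * ln u^-1 <= w by rewrite -ler_pdivlMr// /t; lra.
have -> : (a + b - eta) * u - (a - eta) = t * (1 - u).
  by rewrite /t /v; field; rewrite gt_eqF// subr_gt0.
have [t0|t0] := leP t 0.
  apply: (@le_trans _ _ 0); first by rewrite mulr_le0_ge0//; lra.
  by rewrite mulr_ge0 ?powR_ge0// ltW.
have ut : expR (t * ln u^-1) = (u `^ t)^-1.
  by rewrite lnV ?posrE// mulrN expRN /powR (gt_eqF u0).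
have ut0 : 0 < u `^ t by rewrite powR_gt0.
have : t * ln u^-1 * (u `^ t)^-1 <= z.
  by rewrite -ut -wz ler_pM ?expR_ge0 ?ler_expR// mulr_ge0 ?(ltW t0) ?(ltW L0).
rewrite /z mulrAC ler_pM2r// ler_pdivrMr// -/v.
have -> : u `^ eta = u `^ v * u `^ t.
  by rewrite -powRD ?(gt_eqF u0) ?implybT// /t addrC subrK.
by rewrite mulrA mulrAC ler_pdivlMr// subr_gt0.
Qed.

Lemma Sfun_ineq (R : realType) (a b u eta : R) : 0 < b -> 0 < u < 1 ->
  0 <= eta -> eta <= Sfun a b u ->
  (a + b - eta) * u - (a - eta) <= b * u `^ eta.
Proof.
move=> b0 u01 eta0 etaS; have [a1|a1] := leP a 1; last exact: Sfun_lambert.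
by move: etaS; rewrite /Sfun a1 /= => etaa; apply: le_powR_of_eta_le1; lra.
Qed.

(** So the level (a - eta) / (a + b - eta) lies in [0, 1[.  For 0 < u < 1 and
    eta > 1 this follows from [Sfun_ineq], since u ^ eta <= u makes
    (1 - u) (a - eta) nonnegative. *)
Lemma Sfun_le_a (R : realType) (a b u eta : R) : 0 < b -> 0 <= u <= 1 ->
  0 <= eta -> eta <= Sfun a b u -> eta <= a.
Proof.
move=> b0 u01 eta0 etaS; have [a1|a1] := leP a 1.
  by move: etaS; rewrite /Sfun a1.
have [u0|u0] := eqVneq u 0; first by move: etaS; rewrite /Sfun u0 eqxx orbT.
have [u1|u1] := eqVneq u 1.
  apply: (le_trans etaS).
  rewrite /Sfun (negbTE u0) (leNgt a 1) a1 u1 eqxx/= gerBl.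
  by rewrite mulr_ge0 ?divr_ge0//; lra.
have u01' : 0 < u < 1 by rewrite lt_neqAle eq_sym u0 lt_neqAle u1; lra.
have C := Sfun_ineq _ _ _ _ _ b0 u01' eta0 etaS.
have [e1|e1] := leP eta 1; first lra.
have ue : u `^ eta <= u by rewrite -[leRHS]powRr1 ?ger_powR//; lra.
have bu : b * u `^ eta <= b * u by rewrite ler_pM2l.
have [_ u1'] := andP u01'.
rewrite -subr_ge0 -(pmulr_lge0 _ (_ : 0 < 1 - u)); lra.
Qed.

(** * The tail bound *)

Theorem lemma2p1 (R : realType) (d : measure_display) (T : measurableType d)
    (P : probability T R) (B : {RV P >-> R}) (a b u eta : R)
    (a_gt0 : 0 < a) (b_gt0 : 0 < b) (B_Beta : is_Beta B a b)
    (u_ge0 : 0 <= u) (u_le1 : u <= 1)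
    (eta_ge0 : 0 <= eta) (eta_leS : eta <= Sfun a b u)
    (u_gt : (a - eta) / (a + b - eta) < u) :
  (lne (P [set w | (u <= B w)%R])
     - lne (P [set w | ((a - eta) / (a + b - eta) <= B w)%R])
   <= - ((a + b - eta)%:E * kl ((a - eta) / (a + b - eta)) u))%E.
Proof.
have etaa : eta <= a by apply: Sfun_le_a eta_leS => //; rewrite u_ge0.
have nE : a + b - eta = (a - eta) + b by ring.
rewrite nE in u_gt *.
set al := a - eta in u_gt *; set n := al + b in u_gt *; set p := al / n in u_gt *.
have al0 : 0 <= al by rewrite subr_ge0.
have n0 : 0 < n by rewrite ltr_wpDl.
have np : n * p = al by rewrite /p mulrCA divff ?mulr1// gt_eqF.
have nq : n * (1 - p) = b by rewrite mulrBr np mulr1 /n addrC addKr.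
have p0 : 0 <= p by rewrite divr_ge0// ltW.
(* Forget the value of p, which rewriting would otherwise unfold. *)
move: p np nq p0 u_gt => p np nq p0 u_gt.
have p1 : p < 1 by exact: lt_le_trans u_le1.
have u0 : 0 < u by exact: le_lt_trans u_gt.
have c0 := beta_const_gt0 B a b B_Beta; have tF := is_beta_tail_survival B a b B_Beta.
rewrite !(beta_survivalP B a b B_Beta)//.
set F := beta_survival a b in tF *.
have Fp0 : 0 < F p by apply: (beta_tail_gt0 _ _ _ _ _ c0 tF); rewrite p0.
rewrite [lne (F p)%:E]lne_EFin//.
have [u1|u1] := eqVneq u 1.
  (* The divergence is infinite, but so is the logarithm of P (B >= 1) = 0. *)
  have [_ F1 _] := tF.
  by rewrite /kl u1 eqxx p1 orbT gt0_muley ?lte_fin// F1 le0_lneNy.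
have u01 : 0 < u < 1 by rewrite u0 lt_neqAle u1.
have [_ u1'] := andP u01.
have Fu0 : 0 < F u by apply: (beta_tail_gt0 _ _ _ _ _ c0 tF); rewrite ltW.
rewrite lne_EFin// /kl (gt_eqF u0) (lt_eqF u1')/= lee_fin.
have alE : a = al + eta by rewrite subrK.
have alu : al < n * u by rewrite -np ltr_pM2l.
have Su : n * u - al <= b * u `^ eta by rewrite /n -nE; exact: Sfun_ineq.
have := ratio_le _ _ _ _ _ c0 b_gt0 tF _ _ _ eta_ge0 al0 alE u01 alu Su _ p0 np.
have wu := beta_weight_gt0 _ (- al) (- b) _ u01.
have wp : 0 < beta_weight (- al) (- b) p.
  rewrite mulr_gt0//; last by rewrite powR_gt0// subr_gt0.
  move: p0; rewrite le_eqVlt => /predU1P[p0|p0]; last by rewrite powR_gt0.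
  by rewrite -np -p0 mulr0 oppr0 powRr0.
rewrite -ler_ln ?posrE ?(mulr_gt0 Fu0 wu) ?(mulr_gt0 Fp0 wp)//.
have lnw x : x < 1 -> 0 < beta_weight (- al) (- b) x ->
    ln (beta_weight (- al) (- b) x) = - (al * ln x) - b * ln (1 - x).
  move=> x1; rewrite /beta_weight => w0.
  have w2 : 0 < (1 - x) `^ (- b) by rewrite powR_gt0// subr_gt0.
  have w1 : 0 < x `^ (- al) by rewrite -(pmulr_lgt0 _ w2).
  by rewrite lnM ?posrE// !ln_powR !mulNr.
rewrite [ln (F u * _)]lnM ?posrE// [ln (F p * _)]lnM ?posrE// !lnw//.
have -> : n * (p * ln (p / u) + (1 - p) * ln ((1 - p) / (1 - u))) =
    al * (ln p - ln u) + b * (ln (1 - p) - ln (1 - u)).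
  rewrite mulrDr !mulrA np nq; congr (_ + b * _); last first.
    by rewrite ln_div ?posrE ?subr_gt0.
  move: p0; rewrite le_eqVlt => /predU1P[p0|p0]; last by rewrite ln_div ?posrE.
  by rewrite -np -p0 mulr0 !mul0r.
lra.
Qed.
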